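(* Let $G$ be a finite group and let $S$ be a subset of $G$. The Haar graph $H(G,S)$ is algebraically Cayley if and only if there exist $g\in G$ and $\alpha\in \operatorname{Aut} G$ such that $gS^\alpha=S^{-1}$, $g^\alpha=g$ and $\alpha^2=\iota_g$.
   Context: All groups and graphs are finite and graphs are undirected. For a group $G$ and an arbitrary subset $S\subseteq G$, the Haar graph $H(G,S)$ is the graph with vertex set $G\times\{0,1\}$ and edges $[(x,0),(sx,1)]$ for $x\in G$, $s\in S$. For $g\in G$ let $g_R$ be the permutation of $G\times\{0,1\}$ given by $(x,i)^{g_R}=(xg,i)$, and let $G_R=\{g_R: g\in G\}$; then $G_R\le \operatorname{Aut} H(G,S)$. The Haar graph $X=H(G,S)$ is called algebraically Cayley if there is a subgroup $A\le\operatorname{Aut} X$ with $G_R\le A$ such that $A$ acts regularly (i.e. transitively with trivial point stabilizers) on the vertex set $V(X)$. Maps are written as exponents: $x^\alpha$ is the image of $x$ under $\alpha$, $S^\alpha=\{s^\alpha:s\in S\}$, $gS^\alpha=\{gs^\alpha:s\in S\}$, $S^{-1}=\{s^{-1}:s\in S\}$. For $g\in G$, $\iota_g$ denotes the inner automorphism $x^{\iota_g}=g^{-1}xg$ $(x\in G)$. *)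

(* Defs.v *)
From mathcomp Require Import all_boot all_fingroup.

Set Implicit Arguments.
Unset Strict Implicit.
Unset Printing Implicit Defensive.

Import GroupScope.

(* A graph is a symmetric adjacency relation on a finite vertex type. *)
Definition graph_aut (V : finType) (e : rel V) : {set {perm V}} :=
  [set p : {perm V} | [forall u, forall v, e (p u) (p v) == e u v]].

Lemma graph_autP (V : finType) (e : rel V) (p : {perm V}) :
  reflect (forall u v, e (p u) (p v) = e u v) (p \in graph_aut e).
Proof.
rewrite inE; apply: (iffP 'forall_'forall_eqP) => h u v; exact: h.
Qed.

Lemma graph_aut_group_set (V : finType) (e : rel V) : group_set (graph_aut e).
Proof.
apply/group_setP; split=> [|p q /graph_autP ep /graph_autP eq].
  by apply/graph_autP => u v; rewrite !perm1.
by apply/graph_autP => u v; rewrite !permM eq ep.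
Qed.

Canonical graph_aut_group (V : finType) (e : rel V) :=
  Group (graph_aut_group_set e).

(* Regularity on all of V, for the natural action 'P of permutations. *)
Definition regular_on (V : finType) (A : {group {perm V}}) : Prop :=
  [transitive A, on [set: V] | 'P] /\ (forall v : V, 'C_A[v | 'P] = 1).

Section HaarGraph.

Variable gT : finGroupType.

(* The labels 0 and 1 of the two sides are false and true. *)
Definition haar_vertex : finType := (gT * bool)%type.

Definition haar_graph (S : {set gT}) : rel haar_vertex :=
  fun u v =>
    [exists x : gT, exists s in S,
        ((u == (x, false)) && (v == (s * x, true)))
     || ((v == (x, false)) && (u == (s * x, true)))].

Lemma haar_graph_sym (S : {set gT}) : symmetric (haar_graph S).
Proof.
by move=> u v; apply: eq_existsb => x; apply: eq_existsb => s; rewrite orbC.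
Qed.

Definition rtrans_fun (g : gT) (u : haar_vertex) : haar_vertex :=
  (u.1 * g, u.2).

Lemma rtrans_fun_inj (g : gT) : injective (rtrans_fun g).
Proof. by move=> [x i] [y j] [/mulIg -> ->]. Qed.

Definition rtrans (g : gT) : {perm haar_vertex} := perm (@rtrans_fun_inj g).

Definition right_translations : {set {perm haar_vertex}} :=
  [set rtrans g | g : gT].

Lemma right_translations_sub_aut (S : {set gT}) :
  right_translations \subset graph_aut (haar_graph S).
Proof.
have mono h a b : haar_graph S a b ->
    haar_graph S (rtrans_fun h a) (rtrans_fun h b).
  move=> /existsP[x /existsP[s /andP[Ss /orP[]/andP[/eqP-> /eqP->]]]];
  apply/existsP; exists (x * h); apply/existsP; exists s;
  by rewrite Ss /rtrans_fun /= mulgA !eqxx ?orbT.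
apply/subsetP => _ /imsetP[g _ ->]; apply/graph_autP => u v; rewrite !permE.
apply/idP/idP => [/(mono g^-1)|]; last exact: mono.
by case: u v => [x i] [y j]; rewrite /rtrans_fun /= !mulgK.
Qed.

Definition algebraically_Cayley (S : {set gT}) : Prop :=
  exists A : {group {perm haar_vertex}},
    [/\ A \subset graph_aut (haar_graph S),
        right_translations \subset A
      & regular_on A].

End HaarGraph.

(* Main.v *)
Require Import Defs.
From mathcomp Require Import all_boot all_fingroup cyclic.

Set Implicit Arguments.
Unset Strict Implicit.
Unset Printing Implicit Defensive.

Import GroupScope.

(** Write [R] for the group of right translations, which has order [#|gT|]
    and whose orbits are the two sides of the Haar graph.

    A regular group [A] containing [R] has order [2 * #|gT|], so [R] has index
    2 in [A] and is normal in it.  The element [tau] of [A] that sends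
    [(1, false)] to [(1, true)] therefore normalises [R], and its square lies
    in [R].  Conjugation by [tau] on [R] gives the automorphism [alpha], and
    [tau ^+ 2] is the translation by some [g].  These data determine [tau]: it
    sends [(x, false)] to [(alpha x, true)] and [(x, true)] to
    [(g * alpha x, false)] (lemma [regular_overgroup_twist]).  The element
    [tau ^+ 2] commutes with [tau] and acts on [R] as conjugation by [g],
    whence [alpha g = g] and [alpha ^+ 2] is inner.

    Conversely, for any such [alpha] and [g] the formula for [tau] defines a
    permutation [twist] for which [R] and its coset by [twist] form a group
    (lemma [twist_group_set]); this group is regular because [R] acts
    regularly on each side and [twist] exchanges the sides.

    In both directions the condition [g *: (alpha @: S) = S^-1] says precisely
    that [twist] preserves adjacency (lemma [twist_autP]). *)

Section Haar.

Variable gT : finGroupType.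
Implicit Types (S : {set gT}) (g h x y : gT) (alpha : {perm gT}).

Local Notation V := (haar_vertex gT).
Local Notation R := (right_translations gT).

(** * Adjacency and right translations *)

Lemma haar_graphE S (u v : V) :
  haar_graph S u v =
  (u.2 != v.2) && ((if u.2 then u.1 * v.1^-1 else v.1 * u.1^-1) \in S).
Proof.
case: u v => [x i] [y j] /=; apply/existsP/andP.
  case=> z /existsP[s /andP[Ss]].
  by case/orP=> /andP[/eqP[-> ->] /eqP[-> ->]]; rewrite mulgK.
case: i; case: j => -[] //= _ Sxy; [exists y | exists x]; apply/existsP.
  by exists (x * y^-1); rewrite Sxy mulgKV !eqxx orbT.
by exists (y * x^-1); rewrite Sxy mulgKV !eqxx.
Qed.

Lemma rtransE g (u : V) : rtrans g u = (u.1 * g, u.2).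
Proof. exact: permE. Qed.

Lemma rtransM : {morph @rtrans gT : g h / g * h}.
Proof. by move=> g h; apply/permP=> u; rewrite permM !rtransE /= mulgA. Qed.

Lemma rtrans_inj : injective (@rtrans gT).
Proof.
by move=> g h /permP/(_ (1, false)); rewrite !rtransE /= !mul1g => -[].
Qed.

Lemma rtrans1 : rtrans 1 = 1 :> {perm V}.
Proof. by apply/permP=> -[x i]; rewrite rtransE perm1 mulg1. Qed.

Lemma mem_rtrans g : rtrans g \in R.
Proof. exact: imset_f. Qed.

Lemma right_translations_group_set : group_set R.
Proof.
apply/group_setP; split=> [|_ _ /imsetP[g _ ->] /imsetP[h _ ->]].
  by rewrite -rtrans1 mem_rtrans.
by rewrite -rtransM mem_rtrans.
Qed.

Canonical right_translations_group := Group right_translations_group_set.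

Lemma card_right_translations : #|R| = #|gT|.
Proof. by rewrite card_imset //; apply: rtrans_inj. Qed.

(** * The side-exchanging permutation *)

Definition twist_fun alpha g (u : V) : V :=
  if u.2 then (g * alpha u.1, false) else (alpha u.1, true).

Lemma twist_fun_inj alpha g : injective (twist_fun alpha g).
Proof.
by case=> x [] [y []] //= [] => [/mulgI|] /perm_inj->.
Qed.

Definition twist alpha g : {perm V} := perm (@twist_fun_inj alpha g).

Lemma twistE alpha g (u : V) : twist alpha g u = twist_fun alpha g u.
Proof. exact: permE. Qed.

(** The edge from [(1, false)] to [(s, true)] is sent to a pair with
    [false]-label [g * alpha s] and [true]-label [1], which is an edge exactly
    when [g * alpha s] lies in [S^-1]; translations move this to every edge. *)
Lemma twist_autP S alpha g :
    alpha \in Aut [set: gT] ->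
  reflect (g *: (alpha @: S) = S^-1) (twist alpha g \in graph_aut (haar_graph S)).
Proof.
move=> autA; have alphaM: {morph alpha : x y / x * y}.
  by move=> x y; rewrite -!(autmE autA) morphM ?inE.
have alphaV: {morph alpha : x / x^-1}.
  by move=> x; rewrite -!(autmE autA) morphV ?inE.
have mem_im x : (g * alpha x \in g *: (alpha @: S)) = (x \in S).
  by rewrite mem_lcoset mulKg mem_imset //; apply: perm_inj.
apply: (iffP (graph_autP _ _)) => [autT | eqS [x i] [y j]].
  have im_inv x : (g * alpha x \in S^-1) = (x \in S).
    have:= autT (1, false) (x, true); rewrite !twistE !haar_graphE /=.
    have alpha1: alpha 1 = 1 by rewrite -(autmE autA) morph1.
    by rewrite inE alpha1 invg1 mulg1 mul1g.
  apply/setP=> y; have ->: y = g * alpha (alpha^-1 (g^-1 * y)).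
    by rewrite permKV mulKVg.
  by rewrite mem_im im_inv.
have key a b : (alpha a * (g * alpha b)^-1 \in S) = (b * a^-1 \in S).
  by rewrite -[RHS]mem_im eqS inE alphaM alphaV !invMg invgK mulgA.
by rewrite !twistE !haar_graphE; case: i; case: j; rewrite //= key.
Qed.

Lemma rtrans_twist alpha g h :
    alpha \in Aut [set: gT] ->
  rtrans h * twist alpha g = twist alpha g * rtrans (alpha h).
Proof.
move=> autA; apply/permP=> -[x i]; rewrite !permM rtransE !twistE rtransE.
have alphaM: alpha (x * h) = alpha x * alpha h.
  by rewrite -!(autmE autA) morphM ?inE.
case: i; rewrite /twist_fun /= alphaM //.
by rewrite mulgA.
Qed.

Lemma sqr_twist alpha g :
    alpha \in Aut [set: gT] -> alpha g = g ->
    alpha ^+ 2 = conj_aut [set: gT]%G g ->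
  twist alpha g * twist alpha g = rtrans g.
Proof.
move=> autA fix_g sqrA; apply/permP=> -[x i]; rewrite permM !twistE rtransE.
have sqrE: alpha (alpha x) = x ^ g.
  by rewrite -permM -[alpha * alpha]/(alpha ^+ 2) sqrA conj_autE ?inE.
case: i; rewrite /twist_fun /=; last by rewrite sqrE -conjgC.
by rewrite -(autmE autA) morphM ?inE //= autmE fix_g sqrE -conjgC.
Qed.

(** * From an automorphism to a regular group *)

Definition twist_group alpha g : {set {perm V}} :=
  R :|: twist alpha g *: R.

Lemma twist_group_set alpha g :
    alpha \in Aut [set: gT] -> alpha g = g ->
    alpha ^+ 2 = conj_aut [set: gT]%G g ->
  group_set (twist_group alpha g).
Proof.
move=> autA fix_g sqrA.
have [tR Rt] := (mem_rtrans, sqr_twist autA fix_g sqrA).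
apply/group_setP; split=> [|p q]; first by rewrite inE group1.
case/setUP=> [/imsetP[h _ ->]|/lcosetP[_ /imsetP[h _ ->] ->]];
  case/setUP=> [/imsetP[k _ ->]|/lcosetP[_ /imsetP[k _ ->] ->]].
- by rewrite inE groupM.
- rewrite inE mulgA rtrans_twist // -mulgA -rtransM orbC.
  by rewrite mem_lcoset mulKg tR.
- by rewrite inE -mulgA -rtransM orbC mem_lcoset mulKg tR.
rewrite -mulgA [rtrans h * _]mulgA rtrans_twist // !mulgA Rt -!rtransM.
by rewrite inE tR.
Qed.

Lemma twist_group_regular alpha g (A : {group {perm V}}) :
  A :=: twist_group alpha g -> regular_on A.
Proof.
move=> defA; split=> [|[x i]].
  apply/imsetP; exists (1, false); rewrite ?inE //; apply/esym/setP=> -[x i].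
  rewrite [RHS]inE; apply/orbitP.
  (* The factor [(alpha 1)^-1] corrects the image [(alpha 1, true)] of
     [(1, false)] by [twist]; [alpha] is an arbitrary permutation here. *)
  have memA b : (if b then twist alpha g else 1) * rtrans ((alpha 1)^-1 ^+ b * x)
                 \in A.
    rewrite defA !inE; case: b; last by rewrite mul1g mem_rtrans.
    by rewrite mem_lcoset mulKg mem_rtrans orbT.
  eexists; first exact: (memA i).
  rewrite /= /aperm permM rtransE; case: i {memA} => /=.
    by rewrite twistE /= mulKVg.
  by rewrite perm1 /= !mul1g.
apply/trivgP/subsetP=> p; rewrite inE defA => /andP[Ap /astab1P].
rewrite /= /aperm inE.
case/setUP: Ap => [/imsetP[h _ ->]|/lcosetP[_ /imsetP[h _ ->] ->]].
  rewrite rtransE /= => -[/(canRL (mulKg x))].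
  by rewrite mulVg => ->; rewrite rtrans1.
by rewrite permM twistE rtransE; case: i.
Qed.

(** * From a regular group to an automorphism *)

Lemma regular_card (A : {group {perm V}}) : regular_on A -> #|A| = #|V|.
Proof.
case=> transA stabA; rewrite -(card_orbit_stab 'P A (1, false)) stabA cards1.
by rewrite muln1 (atransP transA) ?inE // cardsT.
Qed.

Lemma right_translations_index2 (A : {group {perm V}}) :
  R \subset A -> regular_on A -> #|A : R| = 2.
Proof.
move=> sRA /regular_card cardA.
by rewrite -divgS // cardA card_right_translations card_prod card_bool mulKn //;
  apply/card_gt0P; exists 1.
Qed.

(** The element sending [(1, false)] to [(1, true)] must be a twist: being in
    the normaliser of [R], it is determined by its action on [R] by
    conjugation and by the images of one vertex on each side, the second of
    which comes from its square. *)
Lemma regular_overgroup_twist (A : {group {perm V}}) :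
    R \subset A -> regular_on A ->
  exists alpha g,
    [/\ alpha \in Aut [set: gT], alpha g = g,
        alpha ^+ 2 = conj_aut [set: gT]%G g & twist alpha g \in A].
Proof.
move=> sRA regA; have idx2 := right_translations_index2 sRA regA.
have [transA _] := regA; have nsRA: R <| A by apply: index2_normal.
have [tau Atau tau0]: exists2 tau, tau \in A & tau (1, false) = (1, true).
  have: (1, true) \in orbit 'P A (1, false) by rewrite (atransP transA) ?inE.
  by case/orbitP=> tau; exists tau.
have nRtau: tau \in 'N(R) by apply: subsetP Atau; apply: normal_norm.
pose a x := (tau (x, false)).1.
have rtau x : rtrans x * tau = tau * rtrans (a x).
  have /imsetP[y _ def_y]: rtrans x ^ tau \in R by rewrite memJ_norm ?mem_rtrans.
  have rty: rtrans x * tau = tau * rtrans y by rewrite conjgC def_y.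
  suffices ->: a x = y by [].
  have:= congr1 (fun p : {perm V} => p (1, false)) rty.
  by rewrite /a !permM !rtransE tau0 /= !mul1g => ->.
have tauF x : tau (x, false) = (a x, true).
  have:= congr1 (fun p : {perm V} => p (1, false)) (rtau x).
  by rewrite !permM !rtransE tau0 /= !mul1g.
have a_inj: injective a.
  by move=> x y eq_a; have:= tauF x; rewrite eq_a -tauF => /perm_inj[].
have aM: {morph a : x y / x * y}.
  move=> x y; apply: rtrans_inj; apply: (mulgI tau).
  by rewrite -rtau !rtransM -mulgA rtau !mulgA rtau.
have [g def_g]: exists g, tau * tau = rtrans g.
  (* The quotient of [A] by [R] has order 2, so it kills squares. *)
  suffices /imsetP[g _ def_g]: tau ^+ 2 \in R by exists g.
  apply: coset_idr; first exact: groupX.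
  rewrite morphX // -[X in _ ^+ X]idx2 -card_quotient ?normal_norm //.
  by apply: expg_cardG; apply: mem_quotient.
have tauT x : tau (x, true) = (g * a x, false).
  have tau1: tau (1, true) = (g, false).
    by rewrite -tau0 -permM def_g rtransE /= mul1g.
  have:= congr1 (fun p : {perm V} => p (1, true)) (rtau x).
  by rewrite !permM !rtransE tau1 /= mul1g.
have autA: perm a_inj \in Aut [set: gT].
  rewrite inE; apply/andP; split; first by apply/subsetP=> x; rewrite inE.
  by apply/morphicP=> x y _ _; rewrite !permE.
exists (perm a_inj), g; split=> //.
- (* [rtrans g] is a power of [tau], hence commutes with it. *)
  rewrite permE; apply: rtrans_inj; apply: (mulgI tau).
  by rewrite -rtau -def_g mulgA.
- apply/permP=> x; rewrite conj_autE ?inE //.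
  rewrite permM !permE; apply: rtrans_inj; apply: (mulgI (tau * tau)).
  rewrite -mulgA -rtau mulgA -rtau -mulgA def_g -!rtransM.
  by rewrite conjgC.
suffices ->: twist (perm a_inj) g = tau by [].
by apply/permP=> -[x []]; rewrite twistE /twist_fun /= permE.
Qed.

End Haar.

Theorem theorem2 (gT : finGroupType) (S : {set gT}) :
  algebraically_Cayley S <->
  exists (g : gT) (alpha : {perm gT}),
    [/\ alpha \in Aut [set: gT],
        g *: (alpha @: S) = S^-1,
        alpha g = g
      & alpha ^+ 2 = conj_aut [set: gT]%G g].
Proof.
split=> [[A [sAX sRA regA]] | [g [alpha [autA eqS fix_g sqrA]]]].
  have [alpha [g [autA fix_g sqrA Atwist]]] := regular_overgroup_twist sRA regA.
  exists g, alpha; split=> //.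
  by apply/(twist_autP S g autA); apply: subsetP Atwist.
pose A := Group (twist_group_set autA fix_g sqrA).
have sRX := right_translations_sub_aut S.
have Xtwist: twist alpha g \in graph_aut (haar_graph S) by apply/twist_autP.
exists A; split; last exact: (@twist_group_regular _ alpha g).
  rewrite subUset sRX; apply/subsetP=> _ /lcosetP[p /(subsetP sRX) Xp ->].
  by rewrite groupM.
exact: subsetUl.
Qed.
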